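(* Let $c_n(t)$ denote the value at $q=-1$ of the $q$-Narayana polynomial $C_n(t;q)$, and let $c(t,z)=\sum_{n\ge 0}c_n(t)z^n$. The generating function $$c(t,z^2)=\sum_{n\ge 0}c_n(t)z^{2n}$$ has the continued fraction expansion of Jacobi type $$c(t,z^2)=\cfrac{1}{1-s_0z-\cfrac{t_0z^2}{1-s_1z-\cfrac{t_1z^2}{1-\ddots}}}$$ with $s_n=0$, $t_{2n}=(-1)^n$ and $t_{2n+1}=(-1)^n t$ for all $n\ge 0$.
   Context: Notation: $[n]=[n]_q=\sum_{j=0}^{n-1}q^j$, $[n]!=\prod_{j=1}^n[j]$, and $\begin{bmatrix}n\\k\end{bmatrix}=\frac{[n]!}{[k]!\,[n-k]!}$ for $0\le k\le n$ (and $0$ otherwise). For $n\ge 1$ the $q$-Narayana polynomials are $$C_n(t;q)=\sum_{k=0}^{n-1}q^{k^2+k}\begin{bmatrix}n\\k\end{bmatrix}\begin{bmatrix}n-1\\k\end{bmatrix}\frac{t^k}{[k+1]},$$ and $c_n(t)=\lim_{q\to-1}C_n(t;q)$ (coefficientwise in $t$); by convention $c_0(t)=1$. For example, $c_1(t)=1$, $c_2(t)=1+t$, $c_3(t)=1+t+t^2$, $c_4(t)=1+2t+2t^2+t^3$. Generating functions are formal power series in $z$ with coefficients in $\mathbb{Z}[t]$. The continued fraction is understood as a formal power series in $z$ (the $z$-adic limit of its finite truncations). Here $t$ is the polynomial variable, while $t_0,t_1,\dots$ (with indices) are the continued fraction coefficients. *)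

(* Defs.v *)
From HB Require Import structures.
From mathcomp Require Import all_boot all_order all_algebra.
From mathcomp Require Import ring lra.
From mathcomp Require Import all_classical all_reals all_analysis.

Set Implicit Arguments.
Unset Strict Implicit.
Unset Printing Implicit Defensive.

Import Order.TTheory GRing.Theory Num.Theory.
Import numFieldNormedType.Exports.

Local Open Scope classical_set_scope.
Local Open Scope ring_scope.

Section QNarayana.
Variable F : fieldType.
Implicit Types (q : F) (n k : nat).

Definition qint q n : F := \sum_(j < n) q ^+ j.

Definition qfact q n : F := \prod_(1 <= j < n.+1) qint q j.

Definition qbin q n k : F :=
  if (k <= n)%N then qfact q n / (qfact q k * qfact q (n - k)) else 0.

(* Evaluated at a given q, hence meaningful only for n >= 1 and q such that
   [1], ..., [n] are nonzero; for real q this means q <> -1 as soon as n > 1. *)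
Definition qNarayana n q : {poly F} :=
  \poly_(k < n)
    (q ^+ (k ^ 2 + k) * qbin q n k * qbin q n.-1 k / qint q k.+1).

End QNarayana.

(* The coefficientwise limit of C_n(t; q) as the real number q tends to -1
   (punctured neighbourhoods: [2] vanishes at -1), as an element of Z[t].
   xget selects the integer which is the limit of the coefficient;
   q1Narayana_lim below shows that there always is one. *)
Definition q1Narayana (R : realType) (n : nat) : {poly int} :=
  if n == 0%N then 1 else
  \poly_(k < n) xget 0 [set m : int |
     (qNarayana n q)`_k @[q --> (-1 : R)^'] --> (m%:~R : R)].

Section Limit.
Variable F : fieldType.

Lemma qintS (q : F) n : qint q n.+1 = 1 + q * qint q n.
Proof.
rewrite /qint big_ord_recl expr0 mulr_sumr; congr (_ + _).
by apply: eq_bigr => i _; rewrite exprS.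
Qed.

Lemma qint_add (q : F) m n : qint q (m + n) = qint q m + q ^+ m * qint q n.
Proof.
rewrite /qint big_split_ord /= mulr_sumr; congr (_ + _).
by apply: eq_bigr => i _; rewrite exprD.
Qed.

Lemma qfact0 (q : F) : qfact q 0 = 1.
Proof. by rewrite /qfact big_geq. Qed.

Lemma qfactS (q : F) n : qfact q n.+1 = qfact q n * qint q n.+1.
Proof. by rewrite /qfact big_nat_recr. Qed.

(* The next two definitions serve only to prove that the limits exist. *)
Fixpoint gaussp (n k : nat) : {poly int} :=
  match n, k with
  | _, 0 => 1
  | 0, _.+1 => 0
  | n'.+1, k'.+1 => gaussp n' k' + 'X^(k'.+1) * gaussp n' k'.+1
  end.

Lemma gaussp0 n : gaussp n 0 = 1. Proof. by case: n. Qed.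

Lemma gaussp_small n k : (n < k)%N -> gaussp n k = 0.
Proof.
elim: n k => [|n IHn] [|k] //= lt_nk.
by rewrite !IHn ?mulr0 ?addr0 // ltnW.
Qed.

Definition evq (q : F) (p : {poly int}) : F := (map_poly intr p).[q].

Lemma evqD (q : F) p1 p2 : evq q (p1 + p2) = evq q p1 + evq q p2.
Proof. by rewrite /evq rmorphD hornerD. Qed.
Lemma evqB (q : F) p1 p2 : evq q (p1 - p2) = evq q p1 - evq q p2.
Proof. by rewrite /evq rmorphB hornerD hornerN. Qed.
Lemma evqM (q : F) p1 p2 : evq q (p1 * p2) = evq q p1 * evq q p2.
Proof. by rewrite /evq rmorphM hornerM. Qed.
Lemma evqXn (q : F) k : evq q 'X^k = q ^+ k.
Proof. by rewrite /evq map_polyXn hornerXn. Qed.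
Lemma evqX (q : F) : evq q 'X = q.
Proof. by rewrite /evq map_polyX hornerX. Qed.
Lemma evq0 q : evq q 0 = 0.
Proof. by rewrite /evq rmorph0 horner0. Qed.
Lemma evq1 q : evq q 1 = 1.
Proof. by rewrite /evq rmorph1 hornerC. Qed.

Section NonZero.
Variable q : F.
Hypothesis q_ok : forall n, qint q n.+1 != 0.

Lemma qfact_neq0 n : qfact q n != 0.
Proof.
by elim: n => [|n IHn]; rewrite ?qfact0 ?oner_neq0 // qfactS mulf_neq0.
Qed.

Lemma gaussp_fact n k : (k <= n)%N ->
  evq q (gaussp n k) * (qfact q k * qfact q (n - k)) = qfact q n.
Proof.
elim: n k => [|n IHn] [|k] //= le_kn.
- by rewrite evq1 !qfact0 !mul1r.
- by rewrite evq1 qfact0 !mul1r.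
- rewrite evqD evqM evqXn subSS.
  have E1 := IHn k le_kn.
  have := le_kn; rewrite ltnS leq_eqVlt => /orP[/eqP->|lt_kn].
    rewrite (gaussp_small (ltnSn n)) evq0 mulr0 addr0 subnn.
    have := IHn n (leqnn n); rewrite subnn => E.
    rewrite qfact0 mulr1 in E.
    by rewrite qfact0 mulr1 !qfactS mulrA E.
  have E2 := IHn k.+1 lt_kn.
  have E3 : (n - k = (n - k.+1).+1)%N by rewrite -subSn.
  have E4 : qint q n.+1 = qint q k.+1 + q ^+ k.+1 * qint q (n - k).
    by rewrite -qint_add addSn subnKC // ltnW.
  rewrite [RHS]qfactS E4 [RHS]mulrDr -{1}E1 -E2 !E3 !qfactS; ring.
Qed.

Lemma qbinE n k : qbin q n k = evq q (gaussp n k).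
Proof.
rewrite /qbin; case: leqP => [le_kn|lt_nk]; last by rewrite gaussp_small ?evq0.
by rewrite -(gaussp_fact le_kn) mulfK // mulf_neq0 // qfact_neq0.
Qed.

End NonZero.

(* [n+1;k][n;k]/[k+1] = [n;k]^2 - q [n;k-1][n;k+1], cf. narayanapE. *)
Definition narayanap (n k : nat) : {poly int} :=
  'X^(k ^ 2 + k) * (gaussp n k ^+ 2 -
    'X * ((if k is k'.+1 then gaussp n k' else 0) * gaussp n k.+1)).

Lemma qbin_ratio (q : F) n k : (forall m, qint q m.+1 != 0) -> (k <= n)%N ->
  qint q k.+1 * qbin q n k.+1 = qint q (n - k) * qbin q n k.
Proof.
move=> q_ok le_kn; rewrite /qbin le_kn; case: ltnP => [lt_kn|le_nk]; last first.
  have -> : (n - k = 0)%N by apply/eqP.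
  by rewrite {2}/qint big_ord0 mul0r mulr0.
have -> : (n - k = (n - k.+1).+1)%N by rewrite -subSn.
rewrite !qfactS; field.
by rewrite !qfact_neq0 // !q_ok.
Qed.

Lemma qbin_ratioS (q : F) n k : (forall m, qint q m.+1 != 0) -> (k <= n)%N ->
  qint q (n - k).+1 * qbin q n.+1 k = qint q n.+1 * qbin q n k.
Proof.
move=> q_ok le_kn; rewrite /qbin le_kn leqW // subSn // !qfactS; field.
by rewrite !qfact_neq0 // !q_ok.
Qed.

Lemma qint_exp (q : F) k : q ^+ k = 1 + (q - 1) * qint q k.
Proof. by rewrite /qint -subrX1 addrC subrK. Qed.

Lemma qint_det (q : F) a b :
  qint q a.+1 * qint q b.+1 - q * (qint q b * qint q a) = qint q (a + b).+1.
Proof. by rewrite -addSn qint_add !qintS exprS (qint_exp q a); ring. Qed.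

Lemma narayanapE (q : F) n k : (forall m, qint q m.+1 != 0) -> (k <= n)%N ->
  q ^+ (k ^ 2 + k) * qbin q n.+1 k * qbin q n k / qint q k.+1 =
  evq q (narayanap n k).
Proof.
move=> q_ok le_kn; rewrite /narayanap evqM evqXn -!mulrA; congr (_ * _).
rewrite evqB expr2 !evqM evqX -!qbinE //.
set pre := evq q (match k with 0 => _ | _ => _ end).
have Epre : qint q (n - k).+1 * pre = qint q k * qbin q n k.
  rewrite /pre; case: k le_kn {pre} => [|k] le_kn.
    by rewrite evq0 {2}/qint big_ord0 mul0r mulr0.
  by rewrite -qbinE // qbin_ratio ?(ltnW le_kn) // -subSn.
have nz1 := q_ok k; have nz2 := q_ok (n - k)%N.
rewrite mulrA; apply: (mulIf nz1); rewrite mulfVK //; apply: (mulfI nz2).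
rewrite [LHS]mulrA qbin_ratioS //.
have := qint_det q (n - k) k; rewrite subnK // => <-.
transitivity (qint q (n - k).+1 * qint q k.+1 * (qbin q n k * qbin q n k) -
  q * ((qint q (n - k).+1 * pre) * (qint q k.+1 * qbin q n k.+1))).
  by rewrite Epre qbin_ratio //; ring.
by ring.
Qed.

End Limit.

Lemma qint_neq0 (R : realType) (q : R) n : q != -1 -> qint q n.+1 != 0.
Proof.
move=> qN1; have [->|q1] := eqVneq q 1.
  rewrite /qint (eq_bigr (fun=> 1)) => [|i _]; last by rewrite expr1n.
  by rewrite sumr_const card_ord pnatr_eq0.
apply: contraNneq q1 => q0.
have : q ^+ n.+1 == 1 by rewrite qint_exp q0 mulr0 addr0.
move/eqP => qn1.
have : `|q| ^+ n.+1 == 1 by rewrite -normrX qn1 normr1.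
rewrite pexpr_eq1 // => /eqP nq1.
have : q ^+ 2 == 1 by rewrite -real_normK ?num_real // nq1 expr1n.
by rewrite sqrf_eq1 (negPf qN1) orbF.
Qed.

Lemma coef_qNarayana_lim (R : realType) n k : exists m : int,
  (qNarayana n q)`_k @[q --> (-1 : R)^'] --> (m%:~R : R).
Proof.
case: n => [|n].
  by exists 0; apply: cvg_near_cst; near=> q; rewrite coef_poly.
have [lt_kn|le_nk] := ltnP k n.+1; last first.
  by exists 0; apply: cvg_near_cst; near=> q; rewrite coef_poly ltnNge le_nk.
exists (narayanap n k).[-1].
have -> : ((narayanap n k).[-1])%:~R = evq (-1 : R) (narayanap n k).
  by rewrite /evq -(rmorphN1 (intr : int -> R)) horner_map.
have cont : evq q (narayanap n k) @[q --> (-1 : R)^'] --> evq (-1 : R) (narayanap n k).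
  by apply/continuous_withinNx; exact: continuous_horner.
apply: cvg_trans cont; apply: near_eq_cvg.
near=> q; rewrite coef_poly lt_kn /= narayanapE // => m.
apply: qint_neq0; near: q; exact: nbhs_dnbhs_neq.
Unshelve. all: by end_near.
Qed.

Lemma q1Narayana_lim (R : realType) n k : (0 < n)%N ->
  (qNarayana n q)`_k @[q --> (-1 : R)^'] --> (((q1Narayana R n)`_k)%:~R : R).
Proof.
case: n => // n _; rewrite /q1Narayana /= coef_poly; case: ltnP => [_|le_nk].
  have [m mP] := coef_qNarayana_lim R n.+1 k.
  exact: (@xgetPex _ 0 [set m : int |
     (qNarayana n.+1 q)`_k @[q --> (-1 : R)^'] --> (m%:~R : R)]
     (ex_intro _ m mP)).
by apply: cvg_near_cst; near=> q; rewrite coef_poly ltnNge le_nk.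
Unshelve. all: by end_near.
Qed.

(* A formal power series in z over A is its coefficient sequence nat -> A.
   The ring product on functions nat -> A is pointwise,
   hence the separate ps_mul. *)
Section PowerSeries.
Variable A : comUnitRingType.
Implicit Types (f g : nat -> A) (s t : nat -> A).

(* a z^d *)
Definition ps_mono (a : A) (d : nat) : nat -> A := fun n => a *+ (n == d).

Definition ps_sub f g : nat -> A := fun n => f n - g n.

Definition ps_mul f g : nat -> A := fun n => \sum_(i < n.+1) f i * g (n - i)%N.

(* The first n coefficients of 1/f. *)
Fixpoint ps_inv_prefix f n : seq A :=
  if n is m.+1 then
    let g := ps_inv_prefix f m in
    rcons g ((f 0%N)^-1 * ((m == 0%N)%:R - \sum_(i < m) f (m - i)%N * g`_i))
  else [::].

Definition ps_inv f : nat -> A := fun n => (ps_inv_prefix f n.+1)`_n.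

Lemma size_ps_inv_prefix f n : size (ps_inv_prefix f n) = n.
Proof. by elim: n => //= n IHn; rewrite size_rcons IHn. Qed.

Lemma nth_ps_inv_prefix f n i : (i < n)%N -> (ps_inv_prefix f n)`_i = ps_inv f i.
Proof.
elim: n => // n IHn; rewrite ltnS leq_eqVlt => /predU1P[-> //|lt_in].
by rewrite /= nth_rcons size_ps_inv_prefix lt_in IHn.
Qed.

Lemma ps_invE f n : ps_inv f n =
  (f 0%N)^-1 * ((n == 0%N)%:R - \sum_(i < n) f (n - i)%N * ps_inv f i).
Proof.
rewrite {1}/ps_inv /= nth_rcons size_ps_inv_prefix ltnn eqxx.
by congr (_ * (_ - _)); apply: eq_bigr => i _; rewrite nth_ps_inv_prefix.
Qed.

Lemma ps_mulC f g n : ps_mul f g n = ps_mul g f n.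
Proof.
rewrite /ps_mul (reindex_inj rev_ord_inj) /=; apply: eq_bigr => i _.
by rewrite subSS subKn ?leq_ord // mulrC.
Qed.

Lemma ps_mulfV f n : f 0%N \is a GRing.unit ->
  ps_mul f (ps_inv f) n = ps_mono 1 0 n.
Proof.
move=> f0; rewrite ps_mulC /ps_mul big_ord_recr /= subnn (ps_invE f n).
set S := \sum_(i < n) f (n - i)%N * ps_inv f i.
have -> : \sum_(i < n) ps_inv f i * f (n - i)%N = S.
  by apply: eq_bigr => i _; rewrite mulrC.
by rewrite [_ * f 0%N]mulrC mulVKr // addrC subrK.
Qed.

(* The substitution z := z^2. *)
Definition ps_subst_sq f : nat -> A := fun n => if odd n then 0 else f n./2.

(* 1/(1 - s_i z - t_i z^2/(1 - ... - t_(i+m-1) z^2/(1 - s_(i+m) z))) *)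
Fixpoint jfrac_trunc s t (m i : nat) : nat -> A :=
  let lin := ps_sub (ps_mono 1 0) (ps_mono (s i) 1) in
  ps_inv (if m is m'.+1 then
            ps_sub lin (ps_mul (ps_mono (t i) 2) (jfrac_trunc s t m' i.+1))
          else lin).

Definition zadic_limit (u : nat -> nat -> A) f : Prop :=
  forall d, exists M, forall m, (M <= m)%N -> forall n, (n <= d)%N -> u m n = f n.

Definition has_jfrac s t f : Prop :=
  zadic_limit (fun m => jfrac_trunc s t m 0) f.

End PowerSeries.

(* Main.v *)
Require Import Defs.
From HB Require Import structures.
From mathcomp Require Import all_boot all_order all_algebra.
From mathcomp Require Import all_classical all_reals all_analysis.
From mathcomp Require Import ring zify.
Set Implicit Arguments.
Unset Strict Implicit.
Unset Printing Implicit Defensive.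
Import Order.TTheory GRing.Theory Num.Theory.
Import numFieldNormedType.Exports.
Local Open Scope ring_scope.

(* The coefficients t_i are 4-periodic, so c(t, x) must satisfy the quadratic
   equation F = 1/(1 - x/(1 - t x/(1 + x/(1 + t x F)))).  At q = -1 the Gaussian
   binomials become binomials of the halves, which gives
     c = 1 + (x + (1 + t) x^2) (P + t Q)(x^2),
   where P = sum_m w^m sum_j C(m, j)^2 y^j, Q = sum_m w^m sum_j C(m, j) C(m, j+1) y^j
   and y = t^2.  Squaring Pascal's rule gives 2 y w Q = (1 - (1 + y) w) P - 1, and
   the three-term recurrence of the Legendre type polynomials P_m is a differential
   equation for P that yields (1 - 2 (1 + y) w + (1 - y)^2 w^2) P^2 = 1. *)

(* The alias hides the canonical pointwise product of functions. *)
Definition powser (A : comUnitRingType) : Type := nat -> A.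
HB.instance Definition _ (A : comUnitRingType) :=
  GRing.Zmodule.copy (powser A) (nat -> A).

(** * Formal power series as a commutative ring, and continued fractions over it *)

Section SeriesRing.
Variable A : comUnitRingType.
Implicit Types (f g h : powser A) (a : A) (n N d : nat).

(** A coefficient of a product involves only coefficients of index at most its own, so ring laws for
    series can be read off polynomial truncations. *)
Lemma ps_mul_poly N f g n : (n < N)%N ->
  ps_mul f g n = ((\poly_(i < N) f i) * (\poly_(i < N) g i))`_n.
Proof.
move=> ltnN; rewrite coefM; apply: eq_bigr => -[i lti] _ /=.
by rewrite !coef_poly !ifT //; lia.
Qed.

Lemma ps_mulA : associative (@ps_mul A : powser A -> powser A -> powser A).
Proof.
move=> f g h; apply/funext => n.
pose T (u : powser A) := \poly_(i < n.+1) u i.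
transitivity ((T f * (T g * T h))`_n).
  rewrite coefM; apply: eq_bigr => -[i lti] _ /=.
  rewrite (@ps_mul_poly n.+1) ?coef_poly ?ifT //; lia.
rewrite mulrA coefM; apply: eq_bigr => -[i lti] _ /=.
rewrite (@ps_mul_poly n.+1 f g i) ?coef_poly ?ifT //; lia.
Qed.

Lemma ps_mul_comm : commutative (@ps_mul A : powser A -> powser A -> powser A).
Proof. by move=> f g; apply/funext => n; exact: ps_mulC. Qed.

Lemma ps_mul_mono a d f n :
  ps_mul (ps_mono a d) f n = if (d <= n)%N then a * f (n - d)%N else 0.
Proof.
rewrite /ps_mul /ps_mono; case: leqP => [le_dn|lt_nd]; last first.
  rewrite big1 // => i _; have /negPf -> : (i : nat) != d by have := ltn_ord i; lia.
  by rewrite mulr0n mul0r.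
have lt_dn : (d < n.+1)%N by [].
rewrite (bigD1 (Ordinal lt_dn)) //= eqxx mulr1n big1 ?addr0 // => i /negPf.
by rewrite -val_eqE /= => ->; rewrite mulr0n mul0r.
Qed.

Lemma ps_mul1 : left_id (ps_mono 1 0 : powser A) (@ps_mul A).
Proof.
by move=> f; apply/funext => n; rewrite ps_mul_mono subn0 mul1r.
Qed.

Lemma ps_mulDl : left_distributive (@ps_mul A : powser A -> powser A -> powser A) +%R.
Proof.
move=> f g h; apply/funext => n; rewrite /ps_mul [RHS]/GRing.add /= -big_split.
by apply: eq_bigr => i _; rewrite mulrDl.
Qed.

Lemma ps_one_neq0 : (ps_mono 1 0 : powser A) != 0.
Proof.
by apply/eqP => /(congr1 (fun f : powser A => f 0%N)) /eqP; rewrite oner_eq0.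
Qed.

HB.instance Definition _ := GRing.Zmodule_isComNzRing.Build (powser A)
  ps_mulA ps_mul_comm ps_mul1 ps_mulDl ps_one_neq0.

Definition psC a : powser A := ps_mono a 0.
Definition psX : powser A := ps_mono 1 1.

Lemma ps_coefM f g n : (f * g) n = \sum_(i < n.+1) f i * g (n - i)%N.
Proof. by []. Qed.
Lemma ps_coef0M f g : (f * g) 0%N = f 0%N * g 0%N.
Proof. by rewrite ps_coefM big_ord1. Qed.
Lemma ps_coefD f g n : (f + g) n = f n + g n. Proof. by []. Qed.
Lemma ps_coefN f n : (- f) n = - f n. Proof. by []. Qed.
Lemma ps_coef1 n : (1 : powser A) n = (n == 0%N)%:R. Proof. by []. Qed.
Lemma ps_coefCM a f n : (psC a * f) n = a * f n.
Proof. by rewrite [LHS]ps_mul_mono subn0. Qed.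
Lemma ps_coefXM f n : (psX * f) n = if n is m.+1 then f m else 0.
Proof. by rewrite [LHS]ps_mul_mono; case: n => //= n; rewrite subn1 mul1r. Qed.

Lemma psC_is_zmod_morphism : zmod_morphism psC.
Proof. by move=> a b; apply/funext => n; exact: mulrnBl. Qed.
Lemma psC_is_monoid_morphism : monoid_morphism psC.
Proof.
split=> // a b; apply/funext => n.
by rewrite ps_coefCM /psC /ps_mono mulrnAr.
Qed.
HB.instance Definition _ := GRing.isZmodMorphism.Build A (powser A) psC
  psC_is_zmod_morphism.
HB.instance Definition _ := GRing.isMonoidMorphism.Build A (powser A) psC
  psC_is_monoid_morphism.

Definition ps_zsq : powser A -> powser A := @ps_subst_sq A.

Lemma ps_zsq_is_zmod_morphism : zmod_morphism ps_zsq.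
Proof.
move=> f g; apply/funext => n.
rewrite !(ps_coefD, ps_coefN) /ps_zsq /ps_subst_sq; case: odd => //.
by rewrite subr0.
Qed.

Lemma ps_zsq_is_monoid_morphism : monoid_morphism ps_zsq.
Proof.
split=> [|f g]; apply/funext => n.
  by rewrite /ps_zsq /ps_subst_sq !ps_coef1; case: n => [|[|n]] //=; case: odd.
rewrite ps_coefM /ps_zsq /ps_subst_sq; case: ifPn => [odd_n|even_n].
  rewrite big1 // => i _; case: ifPn => [_|even_i]; rewrite ?mul0r // ifT ?mulr0 //.
  by rewrite oddB ?odd_n ?(negPf even_i) // -ltnS.
have -> : n = n./2.*2 by rewrite even_halfK.
(* Induction on half the degree, for all [f]: index 0 splits off, index 1 contributes 0, and what
   remains is the product with [f] shifted by one. *)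
rewrite doubleK ps_coefM; elim: {n even_n}n./2 f g => [|m IHm] f g.
  by rewrite !big_ord1.
rewrite doubleS [LHS]big_ord_recl [RHS]big_ord_recl [X in _ = _ + X]big_ord_recl.
rewrite /= mul0r add0r !subn0 -doubleS doubleK odd_double; congr (_ + _).
transitivity (\sum_(i < m.+1) f i.+1 * g (m - i)%N) => //.
rewrite (IHm (fun i => f i.+1)); apply: eq_bigr => i _.
by rewrite /bump /= !add1n !subSS negbK.
Qed.
HB.instance Definition _ := GRing.isZmodMorphism.Build (powser A) (powser A)
  ps_zsq ps_zsq_is_zmod_morphism.
HB.instance Definition _ := GRing.isMonoidMorphism.Build (powser A) (powser A)
  ps_zsq ps_zsq_is_monoid_morphism.

Lemma ps_zsqC a : ps_zsq (psC a) = psC a.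
Proof.
apply/funext => n; rewrite /ps_zsq /ps_subst_sq /psC /ps_mono.
by case: n => [|[|n]] //=; case: odd.
Qed.

Lemma ps_monoE a d : ps_mono a d = psC a * psX ^+ d.
Proof.
elim: d => [|d IHd]; first by rewrite expr0 mulr1.
rewrite exprS mulrCA -IHd; apply/funext => -[|n]; first by rewrite ps_coefXM.
by rewrite ps_coefXM.
Qed.

Lemma ps_zsqX : ps_zsq psX = psX ^+ 2.
Proof.
rewrite -[RHS]mul1r -[1 in RHS](rmorph1 psC) -ps_monoE; apply/funext => n.
rewrite /ps_zsq /ps_subst_sq /psX /ps_mono.
case: ifP => odd_n; first by have /negPf -> : n != 2 by lia.
by have -> : (n./2 == 1%N) = (n == 2) by lia.
Qed.

Lemma ps_mulfV_unit f : f 0%N \is a GRing.unit -> f * ps_inv f = 1.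
Proof. by move=> f0; apply/funext => n; exact: ps_mulfV. Qed.

Definition ps_eqmod N f g := forall n, (n < N)%N -> f n = g n.

Lemma ps_eqmodM N f g h : ps_eqmod N f g -> ps_eqmod N (h * f) (h * g).
Proof.
move=> fg n ltnN; rewrite !ps_coefM; apply: eq_bigr => -[i lti] _ /=; congr (_ * _).
by apply: fg; lia.
Qed.

(** Both inverses are multiples of one series: with [v] the inverse of [f], [v = v * h * g] and
    [h = v * h * f]. *)
Lemma ps_eqmod_inv N f g h : f 0%N \is a GRing.unit ->
  ps_eqmod N f g -> h * g = 1 -> ps_eqmod N (ps_inv f) h.
Proof.
move=> f0 fg hg n ltnN; have := ps_mulfV_unit f0.
set v : powser A := ps_inv f => fV.
have -> : v = v * h * g by rewrite -mulrA hg mulr1.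
have {2}-> : h = v * h * f by rewrite mulrAC [v * f]mulrC fV mul1r.
by apply/esym; apply: (ps_eqmodM _ fg).
Qed.

(** The [r i] play the role of the tails. Each level multiplies the error by [z^2], so the
    truncation of depth [m] started at [i] agrees with [r i] below degree [2m + 2]. *)
Lemma has_jfrac_tails (s t : nat -> A) (r : nat -> powser A) :
  (forall i, r i * (1 - psC (s i) * psX - psC (t i) * psX ^+ 2 * r i.+1) = 1) ->
  has_jfrac s t (r 0%N).
Proof.
move=> rE.
have main m : forall i, ps_eqmod m.*2.+2 (jfrac_trunc s t m i) (r i).
  elim: m => [|m IHm] i; have := rE i; rewrite -{1}[psX]expr1 -!ps_monoE => ri.
    apply: ps_eqmod_inv ri; first by rewrite /ps_sub /ps_mono mulr0n subr0 unitr1.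
    move=> n ltn; rewrite ps_coefD ps_coefN [X in _ - X]ps_mul_mono ifF ?subr0 //.
    lia.
  apply: ps_eqmod_inv ri.
    by rewrite /ps_sub ps_mul_mono /ps_mono mulr0n !subr0 unitr1.
  move=> n ltn; rewrite ps_coefD ps_coefN /ps_sub; congr (_ - _).
  rewrite [RHS]ps_mul_mono ps_mul_mono; case: leqP => // le2n.
  by congr (_ * _); apply: IHm; lia.
move=> d; exists d => m le_dm n le_nd; apply: main.
by rewrite -addnn; lia.
Qed.

End SeriesRing.

(** * The derivation [z d/dz] on power series *)

Section Euler.
Variable A : comUnitRingType.
Implicit Types (f g : powser A).

Definition ps_theta f : powser A := fun n => f n *+ n.

Lemma ps_thetaM f g : ps_theta (f * g) = ps_theta f * g + f * ps_theta g.
Proof.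
apply/funext => n; rewrite ps_coefD !ps_coefM /ps_theta -sumrMnl -big_split.
apply: eq_bigr => i _ /=.
by rewrite mulrnAl mulrnAr -mulrnDr subnKC // -ltnS.
Qed.

Lemma ps_thetaD f g : ps_theta (f + g) = ps_theta f + ps_theta g.
Proof. by apply/funext => n; rewrite /ps_theta !ps_coefD mulrnDl. Qed.

Lemma ps_thetaC (a : A) : ps_theta (psC a) = 0.
Proof.
by apply/funext => -[|n]; rewrite /ps_theta /psC /ps_mono ?mulr0n ?mul0rn.
Qed.

Lemma ps_thetaX : ps_theta (psX A) = psX A.
Proof.
by apply/funext => -[|[|n]]; rewrite /ps_theta /psX /ps_mono /= ?mulr0n ?mul0rn.
Qed.

End Euler.

(** * Generating functions of squares and of adjacent products of binomials *)

Section SquaredBinomials.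

Lemma bin_left (K : comPzRingType) m j :
  j.+1%:R * 'C(m, j.+1)%:R = (m%:R - j%:R) * 'C(m, j)%:R :> K.
Proof.
have [le_jm|lt_mj] := leqP j m; last by rewrite !bin_small ?(leqW lt_mj) ?mulr0.
by rewrite -natrM mul_bin_left natrM natrB.
Qed.

(** In the variable y, [binsq m] is [(1-y)^m L_m((1+y)/(1-y))], where [L_m] is the Legendre
    polynomial. *)
Definition binsq m : {poly int} := \poly_(j < m.+1) 'C(m, j)%:R ^+ 2.
Definition binadj m : {poly int} := \poly_(j < m.+1) ('C(m, j)%:R * 'C(m, j.+1)%:R).

Lemma coef_binsq m j : (binsq m)`_j = 'C(m, j)%:R ^+ 2.
Proof. by rewrite coef_poly; case: leqP => // lt_mj; rewrite bin_small. Qed.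

Lemma binsq0 : binsq 0 = 1.
Proof. by apply/polyP => -[|j]; rewrite coef_binsq coef1. Qed.

Lemma coef_binadj m j : (binadj m)`_j = 'C(m, j)%:R * 'C(m, j.+1)%:R.
Proof. by rewrite coef_poly; case: leqP => // lt_mj; rewrite bin_small ?mul0r. Qed.

Lemma coef_natM (K : nzRingType) n (p : {poly K}) j : (n%:R * p)`_j = n%:R * p`_j.
Proof. by rewrite !mulr_natl coefMn. Qed.

Lemma binadjE m : 2 * 'X * binadj m = binsq m.+1 - (1 + 'X) * binsq m.
Proof.
apply/polyP => j; rewrite -mulrA coef_natM coefB [(1 + 'X) * _]mulrDl mul1r coefD !coefXM.
case: j => [|j]; rewrite /= !(coef_binsq, coef_binadj).
  by rewrite !bin0; ring.
by rewrite binS natrD; ring.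
Qed.

(** Bonnet's recurrence for the Legendre polynomials, with the denominators [1 - y] cleared. *)
Lemma binsq_rec m : m.+2%:R * binsq m.+2 =
  (2 * m + 3)%:R * (1 + 'X) * binsq m.+1 - m.+1%:R * (1 - 'X) ^+ 2 * binsq m.
Proof.
have -> : (2 * m + 3)%:R * (1 + 'X) * binsq m.+1 - m.+1%:R * (1 - 'X) ^+ 2 * binsq m =
  (2 * m + 3)%:R * (binsq m.+1 + 'X * binsq m.+1) -
    m.+1%:R * (binsq m - 2 * ('X * binsq m) + 'X * ('X * binsq m)) by ring.
apply/polyP => j; rewrite !(coef_natM, coefB, coefD, coefXM).
case: j => [|[|j]]; rewrite /= !coef_binsq ?bin0 ?bin1.
- ring.
- ring.
have := bin_left int m j; have := bin_left int m j.+1.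
rewrite !binS !natrD.
set a : int := 'C(m, j)%:R; set b : int := 'C(m, j.+1)%:R; set c : int := 'C(m, j.+2)%:R.
move/eqP; rewrite -subr_eq0 => /eqP E2; move/eqP; rewrite -subr_eq0 => /eqP E1.
apply/eqP; rewrite -subr_eq0; apply/eqP.
(* After Pascal's rule the difference of the two sides is a combination of the ratio relations [E2]
   and [E1]; the cofactors [a + b] and [b + c] are the binomials of [m.+1] over [j.+1] and
   [j.+2]. *)
transitivity (2 * ((a + b) * (j.+2%:R * c - (m%:R - j.+1%:R) * b)
  - (b + c) * (j.+1%:R * b - (m%:R - j%:R) * a))); first ring.
by rewrite E1 E2; ring.
Qed.

(** The series P and Q in the variable w, with ['X^2] put for y. *)
Definition legP : powser {poly int} := fun m => binsq m \Po 'X^2.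
Definition legQ : powser {poly int} := fun m => binadj m \Po 'X^2.

Let w := psX {poly int}.
Let y := psC ('X^2 : {poly int}).

Lemma legQE : 2 * y * w * legQ = (1 - (1 + y) * w) * legP - 1.
Proof.
have -> : 2 * y * w * legQ = psC (2 * 'X^2) * (w * legQ).
  by rewrite [psC _]rmorphM rmorph_nat; ring.
have -> : (1 - (1 + y) * w) * legP = legP - psC (1 + 'X^2) * (w * legP).
  by rewrite [psC _]rmorphD rmorph1; ring.
apply/funext => -[|m]; rewrite !(ps_coefD, ps_coefN, ps_coefCM, ps_coefXM, ps_coef1) /=.
  by rewrite !mulr0 subr0 /legP binsq0 comp_polyC subrr.
rewrite subr0 /legP /legQ; have := congr1 (fun p => p \Po 'X^2) (binadjE m).
by rewrite !(rmorph_nat, rmorphM, rmorphB, rmorphD, rmorph1) /= comp_polyX.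
Qed.

Lemma legP_rec m : m.+2%:R * legP m.+2 =
  (2 * m + 3)%:R * (1 + 'X^2) * legP m.+1 - m.+1%:R * (1 - 'X^2) ^+ 2 * legP m.
Proof.
have := congr1 (fun p => p \Po 'X^2) (binsq_rec m).
by rewrite !(rmorph_nat, rmorphM, rmorphXn, rmorphB, rmorphD, rmorph1) /= comp_polyX.
Qed.

(** The recurrence summed against [w^(m+2)]: index factors become [ps_theta], with
    [2m + 3 = 2(m+1) + 1] and [m + 1] leaving the terms without derivative. *)
Lemma legP_ode :
  (1 - 2 * (1 + y) * w + (1 - y) ^+ 2 * w ^+ 2) * ps_theta legP =
  ((1 + y) * w - (1 - y) ^+ 2 * w ^+ 2) * legP.
Proof.
set L := LHS; set M := RHS.
have -> : L = ps_theta legP - psC (2 * (1 + 'X^2)) * (w * ps_theta legP)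
   + psC ((1 - 'X^2) ^+ 2) * (w * (w * ps_theta legP)).
  by rewrite /L /y !(rmorph_nat, rmorphM, rmorphXn, rmorphB, rmorphD, rmorph1) /=; ring.
have -> : M = psC (1 + 'X^2) * (w * legP) - psC ((1 - 'X^2) ^+ 2) * (w * (w * legP)).
  by rewrite /M /y !(rmorph_nat, rmorphM, rmorphXn, rmorphB, rmorphD, rmorph1) /=; ring.
apply/funext => -[|[|m]]; rewrite !(ps_coefD, ps_coefN, ps_coefCM, ps_coefXM) /ps_theta /=.
- by ring.
- rewrite ?mulr0n !mulr1n !mulr0 !subr0 addr0.
  (* Degree 1 lies below the recurrence; it amounts to [binsq 1 = (1 + y) * binsq 0]. *)
  rewrite /legP -[1 + 'X^2](_ : (1 + 'X) \Po 'X^2 = _).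
    rewrite -rmorphM; congr (_ \Po _); apply/polyP => j.
    rewrite mulrDl mul1r coefD coefXM !coef_binsq.
    by case: j => [|[|[|j]]]; rewrite //= coef_binsq.
  by rewrite rmorphD /= comp_polyX rmorph1.
have := legP_rec m; move: (legP m) (legP m.+1) (legP m.+2).
move=> p0 p1 p2 E; rewrite -[p2 *+ _]mulr_natl E; ring.
Qed.

(** With [D] the quadratic factor, [ps_theta D] is [-2] times the right-hand coefficient in
    [legP_ode], so [ps_theta] kills [D * legP ^+ 2]. The coefficients are torsion-free, hence this
    series is its constant term 1. *)
Lemma legP_sqr : (1 - 2 * (1 + y) * w + (1 - y) ^+ 2 * w ^+ 2) * legP ^+ 2 = 1.
Proof.
set D := (X in X * _).
have DE : D = 1 + psC (- (2 * (1 + 'X^2))) * w + psC ((1 - 'X^2) ^+ 2) * (w * w).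
  by rewrite /D /y
    !(rmorph_nat, rmorphN, rmorphM, rmorphXn, rmorphB, rmorphD, rmorph1) /=; ring.
have thetaD : ps_theta D = - 2 * ((1 + y) * w - (1 - y) ^+ 2 * w ^+ 2).
  rewrite DE -(rmorph1 (@psC _)) !(ps_thetaD, ps_thetaM, ps_thetaC, ps_thetaX).
  by rewrite /y /w
    !(rmorph_nat, rmorphN, rmorphM, rmorphXn, rmorphB, rmorphD, rmorph1) /=; ring.
have theta0 : ps_theta (D * legP ^+ 2) = 0.
  rewrite expr2 !ps_thetaM thetaD.
  transitivity (2 * legP * (D * ps_theta legP -
    ((1 + y) * w - (1 - y) ^+ 2 * w ^+ 2) * legP)); first ring.
  by rewrite legP_ode subrr mulr0.
apply/funext => -[|n].
  rewrite expr2 !ps_coef0M DE.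
  rewrite !(ps_coefD, ps_coefCM, ps_coefXM, ps_coef1) /= !mulr0 !addr0 mul1r.
  by rewrite /legP binsq0 comp_polyC mulr1.
have E : (D * legP ^+ 2) n.+1 *+ n.+1 = 0.
  exact: (congr1 (fun f : powser _ => f n.+1) theta0).
apply/polyP => k; have /eqP := congr1 (fun p : {poly int} => p`_k) E.
by rewrite coefMn !coef0 mulrn_eq0 => /eqP.
Qed.

End SquaredBinomials.

(** * The polynomials at q = -1 *)

(** The q-Lucas theorem at -1. In the q-Pascal rule for an even upper index the two terms are equal
    up to sign and cancel (odd lower index) or add by Pascal's rule (even lower index); for an odd
    upper index one of them vanishes. *)
Lemma horner_gauss_N1 n k : (gaussp n k).[-1] =
  if ~~ odd n && odd k then 0 else 'C(n./2, k./2)%:R.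
Proof.
elim: n k => [|n IHn] [|k] /=.
- by rewrite hornerC.
- by rewrite horner0; case: k => [|k] //=; case: odd.
- by rewrite hornerC andbF bin0.
- rewrite hornerD hornerM hornerXn !IHn /= !uphalf_half exprS -signr_odd.
  by case: (odd n); case: (odd k); rewrite /= ?add0n ?add1n ?binS ?natrD ?expr0 ?expr1; ring.
Qed.

(** Near -1 the coefficient is the denominator-free polynomial [narayanap n k] in q, so its limit is
    the value there, and limits are unique. *)
Lemma coef_q1Narayana (R : realType) n k :
  (q1Narayana R n.+1)`_k = (narayanap n k).[-1].
Proof.
have [le_kn|lt_nk] := leqP k n; last first.
  rewrite coef_poly ltnNge lt_nk /= /narayanap !gaussp_small ?(leqW lt_nk) //.
  by rewrite mulr0 expr0n mulr0 subr0 mulr0 horner0.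
have lim_q1 := @q1Narayana_lim R n.+1 k isT.
apply: (@intr_inj R); apply: cvg_unique lim_q1 _ => //.
have -> : ((narayanap n k).[-1])%:~R = evq (-1 : R) (narayanap n k).
  by rewrite /evq -(rmorphN1 (intr : int -> R)) horner_map.
have : (evq q (narayanap n k) @[q --> (-1 : R)^'] --> evq (-1 : R) (narayanap n k))%classic.
  by apply/continuous_withinNx; exact: continuous_horner.
apply: cvg_trans; apply: near_eq_cvg.
near=> q; rewrite coef_poly ltnS le_kn /= narayanapE // => m.
by apply: qint_neq0; near: q; exact: nbhs_dnbhs_neq.
Unshelve. all: by end_near.
Qed.

(** The exponent [k ^ 2 + k] is even, and the factor [-q] becomes 1. *)
Lemma horner_narayana_N1 n k : (narayanap n k).[-1] =
  (gaussp n k).[-1] ^+ 2 +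
  (if k is k'.+1 then (gaussp n k').[-1] else 0) * (gaussp n k.+1).[-1].
Proof.
rewrite /narayanap hornerM hornerXn -signr_odd oddD oddX /= addbb expr0 mul1r.
rewrite hornerD hornerN !hornerM hornerX.
by case: k => [|k]; rewrite ?horner0; ring.
Qed.

Lemma coef_legP m k : (legP m)`_k = if odd k then 0 else 'C(m, k./2)%:R ^+ 2.
Proof.
rewrite /legP coef_comp_poly_Xn // dvdn2 divn2; case: odd => //=.
by rewrite coef_binsq.
Qed.

Lemma coef_legQ m k :
  (legQ m)`_k = if odd k then 0 else 'C(m, k./2)%:R * 'C(m, k./2.+1)%:R.
Proof.
rewrite /legQ coef_comp_poly_Xn // dvdn2 divn2; case: odd => //=.
by rewrite coef_binadj.
Qed.

(** The upper index [2m] is even, so odd lower indices give 0: the square survives for even [k], the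
    product of neighbours for odd [k]. *)
Lemma q1Narayana_odd (R : realType) m :
  q1Narayana R m.*2.+1 = legP m + 'X * legQ m.
Proof.
apply/polyP => k; rewrite coef_q1Narayana horner_narayana_N1 coefD coefXM.
rewrite coef_legP; case: k => [|k]; rewrite /= !horner_gauss_N1 odd_double doubleK /=.
  by rewrite mul0r.
rewrite coef_legQ uphalf_half; case: (odd k); rewrite /= ?add1n ?add0n; ring.
Qed.

(** The upper index [2m + 1] is odd, so parity kills neither product: they are the coefficients of
    degrees [k] and [k - 1] of the preceding polynomial. *)
Lemma q1Narayana_even (R : realType) m :
  q1Narayana R m.*2.+2 = (1 + 'X) * q1Narayana R m.*2.+1.
Proof.
rewrite q1Narayana_odd; apply/polyP => k.
rewrite coef_q1Narayana horner_narayana_N1 mulrDl mul1r !(coefXM, coefD).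
case: k => [|[|k]]; rewrite !horner_gauss_N1 /= odd_double uphalf_double /=
  ?coef_legP ?coef_legQ /= ?coef_legP ?coef_legQ.
- ring.
- by rewrite !bin0; ring.
- by rewrite negbK !uphalf_half; case: (odd k); rewrite /= ?add1n ?add0n; ring.
Qed.

(** * The quadratic equation and the continued fraction *)

Lemma ps_q1NarayanaE (R : realType)
    (x := psX {poly int}) (T := psC ('X : {poly int})) :
  (q1Narayana R : powser {poly int}) = 1 + (x + (1 + T) * x ^+ 2) *
    (ps_zsq legP + T * ps_zsq legQ).
Proof.
set G : powser _ := ps_zsq legP + _.
(* [G] holds the polynomials of odd index, moved down by one degree; [x * G] restores them and
   [(1 + T) * x ^+ 2 * G] gives those of even index from 2 on. *)
have GE n : G n = if odd n then 0 else q1Narayana R n.+1.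
  rewrite /G ps_coefD ps_coefCM /ps_zsq /ps_subst_sq; case: ifPn => [_|even_n].
    by rewrite mulr0 addr0.
  by rewrite -{3}(even_halfK even_n) q1Narayana_odd.
have -> : (x + (1 + T) * x ^+ 2) * G = x * G + psC (1 + 'X) * (x * (x * G)).
  by rewrite rmorphD rmorph1 -/T; ring.
apply/funext => n; rewrite !(ps_coefD, ps_coefCM, ps_coefXM, ps_coef1).
case: n => [|[|n]]; rewrite ?ps_coefXM /= ?GE ?mulr0 ?addr0 ?add0r //.
rewrite /=; case: (boolP (odd n)) => [odd_n|even_n] /=; rewrite ?mulr0 ?addr0 ?add0r //.
by rewrite -(even_halfK even_n) q1Narayana_even.
Qed.

(* Multiplied by [2 t x], the first hypothesis reads
   [2 t x F = (1 + x - t x) (g P - 1)] with [g = (1 + t x)^2 - x^2],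
   and [D = ((1 - t x)^2 - x^2) g]: this is the quadratic formula. *)
Lemma narayana_quadratic (K : comNzRingType) (x T P Q F : K) :
  F = 1 + (x + (1 + T) * x ^+ 2) * (P + T * Q) ->
  2 * T ^+ 2 * x ^+ 2 * Q = (1 - (1 + T ^+ 2) * x ^+ 2) * P - 1 ->
  (1 - 2 * (1 + T ^+ 2) * x ^+ 2 + (1 - T ^+ 2) ^+ 2 * (x ^+ 2) ^+ 2) * P ^+ 2 = 1 ->
  4 * (T * (x * (T * x * (1 - T * x - x) * F ^+ 2
    + (1 - T * x - x) * (1 - T * x + x) * F - (1 - T * x + x)))) = 0.
Proof.
move=> FE QE PE.
pose b := 1 - T * x + x; pose a := 1 - T * x - x; pose g := (1 + T * x) ^+ 2 - x ^+ 2.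
have F2 : 2 * T * x * F = b * (g * P - 1).
  transitivity (2 * T * x + (1 + x + T * x) *
    (2 * T * x ^+ 2 * P + 2 * T ^+ 2 * x ^+ 2 * Q)); first by rewrite FE; ring.
  by rewrite QE /b /g; ring.
transitivity (a * (2 * T * x * F) ^+ 2 + 2 * (a * b) * (2 * T * x * F) - 4 * T * x * b).
  by rewrite /a /b; ring.
rewrite F2; transitivity (b * g * ((1 - 2 * (1 + T ^+ 2) * x ^+ 2
    + (1 - T ^+ 2) ^+ 2 * (x ^+ 2) ^+ 2) * P ^+ 2 - 1)).
  by rewrite /a /b /g; ring.
by rewrite PE subrr mulr0.
Qed.

Lemma jfrac_tails_close (K : comNzRingType) (x T F r1 r2 r3 : K) :
  T * x * (1 - T * x - x) * F ^+ 2
    + (1 - T * x - x) * (1 - T * x + x) * F - (1 - T * x + x) = 0 ->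
  r3 * (1 + T * x * F) = 1 -> r2 * (1 + x * r3) = 1 -> r1 * (1 - T * x * r2) = 1 ->
  F * (1 - x * r1) = 1.
Proof.
move=> FE E3 E2 E1.
pose u := 1 + T * x * F; pose v := 1 + x * r3; pose w := 1 - T * x * r2.
have uvE : u * v = 1 + x + T * x * F.
  transitivity (u + x * (r3 * u)); first by rewrite /v; ring.
  by rewrite E3 /u; ring.
have uvwE : u * v * w = 1 + x - T * x + T * x * (1 - T * x) * F.
  transitivity (u * v - T * x * u * (r2 * v)); first by rewrite /w; ring.
  by rewrite E2 uvE /u; ring.
have M1 : (r3 * u) * (r2 * v) * (r1 * w) = 1 by rewrite E3 E2 E1 !mulr1.
transitivity (F * (1 - x * r1) * ((r3 * u) * (r2 * v) * (r1 * w))).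
  by rewrite M1 mulr1.
rewrite -[RHS]M1.
transitivity (r3 * r2 * r1 * (F * (u * v * w - x * (u * v) * (r1 * w)))); first ring.
transitivity (r3 * r2 * r1 * (u * v * w)); last ring.
congr (_ * _); rewrite E1 mulr1 uvwE uvE; apply/eqP; rewrite -subr_eq0 -[X in _ == X]FE.
by apply/eqP; ring.
Qed.

Lemma psC_mulI (A : idomainType) (a : A) (f : powser A) :
  a != 0 -> psC a * f = 0 -> f = 0.
Proof.
move=> a0 af0; apply/funext => n; apply: (mulfI a0).
by rewrite -ps_coefCM af0 mulr0.
Qed.

Lemma psX_mulI (A : comUnitRingType) (f : powser A) : psX A * f = 0 -> f = 0.
Proof.
move=> xf0; apply/funext => n; have := congr1 (fun g : powser A => g n.+1) xf0.
by rewrite ps_coefXM.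
Qed.

Lemma ps_q1Narayana_quadratic (R : realType)
    (x := psX {poly int}) (T := psC ('X : {poly int}))
    (F := q1Narayana R : powser {poly int}) :
  T * x * (1 - T * x - x) * F ^+ 2
    + (1 - T * x - x) * (1 - T * x + x) * F - (1 - T * x + x) = 0.
Proof.
have TE : psC ('X^2 : {poly int}) = T ^+ 2 by rewrite rmorphXn.
have := congr1 (@ps_zsq _) legQE.
have := congr1 (@ps_zsq _) legP_sqr.
rewrite TE !(rmorph_nat, rmorphM, rmorphXn, rmorphB, rmorphD, rmorph1) /= -!expr2.
rewrite ps_zsqX ps_zsqC => PE QE.
have := narayana_quadratic (ps_q1NarayanaE R) QE PE.
set E := (X in 4 * (T * (x * X))) => /=.
(* The factors 4, [T] and [x] are cancelled one at a time. *)
rewrite -(rmorph_nat (@psC {poly int}) 4) => /psC_mulI E0.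
apply: (@psX_mulI _ E); apply: (@psC_mulI _ 'X); first by rewrite polyX_eq0.
by apply: E0; rewrite -polyC_natr polyC_eq0.
Qed.

Theorem theorem3 (R : realType) (s t : nat -> {poly int})
    (hs : forall n : nat, s n = 0)
    (ht_even : forall n : nat, t (2 * n)%N = (-1) ^+ n)
    (ht_odd : forall n : nat, t (2 * n + 1)%N = (-1) ^+ n * 'X) :
  has_jfrac s t (ps_subst_sq (q1Narayana R)).
Proof.
pose x := psX {poly int}; pose T := psC ('X : {poly int}).
pose F : powser {poly int} := q1Narayana R.
(* Tails in the variable [x], built outwards from [F], which by periodicity is also the fourth tail;
   the coefficients are 1, t, -1, -t. *)
pose r3 : powser {poly int} := ps_inv (1 + T * x * F).
pose r2 : powser {poly int} := ps_inv (1 + x * r3).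
pose r1 : powser {poly int} := ps_inv (1 - T * x * r2).
have E3 : r3 * (1 + T * x * F) = 1.
  rewrite mulrC ps_mulfV_unit // -mulrA !(ps_coefD, ps_coefCM, ps_coefXM).
  by rewrite mulr0 addr0 unitr1.
have E2 : r2 * (1 + x * r3) = 1.
  by rewrite mulrC ps_mulfV_unit // !(ps_coefD, ps_coefXM) addr0 unitr1.
have E1 : r1 * (1 - T * x * r2) = 1.
  rewrite mulrC ps_mulfV_unit // -mulrA !(ps_coefD, ps_coefN, ps_coefCM, ps_coefXM).
  by rewrite mulr0 subr0 unitr1.
have E0 : F * (1 - x * r1) = 1.
  exact: jfrac_tails_close (ps_q1Narayana_quadratic R) E3 E2 E1.
pose r i : powser {poly int} := ps_zsq (nth 0 [:: F; r1; r2; r3] (i %% 4)).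
apply: (@has_jfrac_tails _ s t r) => i.
(* Substituting [x = z^2] turns a level with linear term [a x] into a Jacobi level with [s = 0]. *)
have sq (f g h : powser {poly int}) a : f * (1 - psC a * x * g) = 1 ->
    ps_zsq f * (1 - psC 0 * x - psC a * x ^+ 2 * ps_zsq g) = 1.
  move=> /(congr1 (@ps_zsq _)).
  rewrite !(rmorph_nat, rmorphM, rmorphXn, rmorphB, rmorphD, rmorph1) /=.
  by rewrite ps_zsqX ps_zsqC rmorph0 mul0r subr0.
have tE : t i = nth 0 [:: 1; 'X; -1; - 'X] (i %% 4).
  have := ltn_pmod i (isT : 0 < 4)%N; rewrite [in LHS](divn_eq i 4).
  case: (i %% 4)%N => [|[|[|[|//]]]] _ /=.
  - by rewrite (_ : _ + 0 = 2 * (2 * (i %/ 4)))%N ?ht_even ?exprM ?sqrrN ?expr1n //; lia.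
  - by rewrite (_ : _ + 1 = 2 * (2 * (i %/ 4)) + 1)%N ?ht_odd
      ?exprM ?sqrrN ?expr1n ?mul1r //; lia.
  - by rewrite (_ : _ + 2 = 2 * (2 * (i %/ 4)).+1)%N ?ht_even
      ?exprS ?exprM ?sqrrN ?expr1n ?mulr1 //; lia.
  - by rewrite (_ : _ + 3 = 2 * (2 * (i %/ 4)).+1 + 1)%N ?ht_odd
      ?exprS ?exprM ?sqrrN ?expr1n ?mulr1 ?mulN1r //; lia.
have -> : r i.+1 = ps_zsq (nth 0 [:: F; r1; r2; r3] ((i %% 4).+1 %% 4)).
  by rewrite /r -addn1 -modnDml addn1.
rewrite hs tE /r; have := ltn_pmod i (isT : 0 < 4)%N.
by case: (i %% 4)%N => [|[|[|[|//]]]] _ /=; apply: sq;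
  rewrite ?rmorphN ?rmorph1 ?mulN1r ?mulNr ?opprK ?mul1r.
Qed.
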